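(* Let $(\Omega,\mathcal{F})$ be a standard Borel space. Let $E_1\subseteq E_2\subseteq\cdots$ be equivalence relations on $\Omega$ and let $\mathcal{G}_1\supseteq\mathcal{G}_2\supseteq\cdots$ be sub-$\sigma$-algebras of $\mathcal{F}$ such that for each $n\in\mathbb{N}$ the pair $(E_n,\mathcal{G}_n)$ satisfies strong duality. Then the pair $\left(\bigcup_{n\in\mathbb{N}}E_n,\bigcap_{n\in\mathbb{N}}\mathcal{G}_n\right)$ satisfies strong duality.
   Context: $\mathcal{P}(\Omega,\mathcal{F})$ is the set of probability measures on $(\Omega,\mathcal{F})$, and for $\mathbb{P},\mathbb{P}'\in\mathcal{P}(\Omega,\mathcal{F})$, $\Pi(\mathbb{P},\mathbb{P}')$ is the set of couplings, i.e. probability measures on $(\Omega\times\Omega,\mathcal{F}\otimes\mathcal{F})$ with first marginal $\mathbb{P}$ and second marginal $\mathbb{P}'$. For an equivalence relation $E$ on $\Omega$ (viewed as a subset of $\Omega\times\Omega$) and a sub-$\sigma$-algebra $\mathcal{G}$ of $\mathcal{F}$, the pair $(E,\mathcal{G})$ satisfies strong duality if $E\in\mathcal{F}\otimes\mathcal{F}$ and, for all $\mathbb{P},\mathbb{P}'\in\mathcal{P}(\Omega,\mathcal{F})$, $$\max_{A\in\mathcal{G}}|\mathbb{P}(A)-\mathbb{P}'(A)|=\min_{\tilde{\mathbb{P}}\in\Pi(\mathbb{P},\mathbb{P}')}(1-\tilde{\mathbb{P}}(E)),$$ where max and min assert that the supremum and infimum are both attained. *)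

(* Defs.v *)
From HB Require Import structures.
From mathcomp Require Import all_boot all_order all_algebra.
From mathcomp Require Import all_classical all_reals all_analysis.
From Stdlib Require Import RelationClasses.

Set Implicit Arguments.
Unset Strict Implicit.
Unset Printing Implicit Defensive.

Import Order.TTheory GRing.Theory Num.Theory.
Import numFieldNormedType.Exports.

Local Open Scope classical_set_scope.
Local Open Scope ring_scope.
Local Open Scope ereal_scope.

Definition complete_metric_space (R : realType) (X : metricType R) : Prop :=
  forall F : set_system X, ProperFilter F -> cauchy F ->
    exists x : X, F --> x.

Definition separable_space (X : topologicalType) : Prop :=
  exists2 D : set X, countable D & dense D.

(* [metricType] carries no distinguished point, so the Borel sets of [X] are
   written [<<s open >>] instead of going through [g_sigma_algebraType]. *)
Definition standard_borel (R : realType) (d : measure_display)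
    (T : measurableType d) : Prop :=
  exists X : metricType R,
    [/\ complete_metric_space X, separable_space X &
      exists (f : T -> X) (g : X -> T),
        [/\ cancel f g, cancel g f,
            forall B : set X, <<s @open X >> B -> measurable (f @^-1` B) &
            forall A : set T, measurable A -> <<s @open X >> (g @^-1` A)]].

Definition equivalence_set (T : Type) (E : set (T * T)) : Prop :=
  Equivalence (fun x y : T => E (x, y)).

Definition sub_sigma_algebra_of (d : measure_display) (T : measurableType d)
    (G : set (set T)) : Prop :=
  sigma_algebra [set: T] G /\ G `<=` measurable.

(* Marginals are compared on measurable sets only: a measure is a total
   function on sets, with unspecified values on the nonmeasurable ones. *)
Definition couplings (R : realType) (d : measure_display)
    (T : measurableType d) (P P' : probability T R)
    : set (probability (T * T)%type R) :=
  [set Q : probability (T * T)%type R | forall A : set T, measurable A ->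
     pushforward Q fst A = P A /\ pushforward Q snd A = P' A].

Definition strong_duality (R : realType) (d : measure_display)
    (T : measurableType d) (E : set (T * T)) (G : set (set T)) : Prop :=
  measurable E /\
  forall P P' : probability T R,
    let gaps := [set `|P A - P' A| | A in G] in
    let costs := [set 1 - Q E | Q in couplings P P'] in
    [/\ gaps (ereal_sup gaps), costs (ereal_inf costs) &
        ereal_sup gaps = ereal_inf costs].

(* Main.v *)
(* Complementary slackness: an E-invariant set A in G and a coupling Q are both
   optimal, with no duality gap, as soon as Q(fst^-1(~A) \ E) = 0 and
   Q(snd^-1(A) \ E) = 0; strong duality provides such a pair for any two finite
   measures of equal mass.  Starting from (P, P'), couple optimally for
   (E_0, G_0), keep the part of the coupling lying in E_0, couple the residual
   marginals optimally for (E_1, G_1), and so on.  The matched parts add up to a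
   measure M carried by the union E of the E_n.  What is left of P and P' once
   the marginals of M are removed is dominated by every residual pair, hence it
   is separated by all the sets A_n in G_n obtained along the way, and so by
   their limsup, which lies in every G_n.  Completing M by an arbitrary coupling
   of these leftovers gives a coupling that, together with limsup A_n, satisfies
   complementary slackness for E. *)
Require Import Defs.
From HB Require Import structures.
From mathcomp Require Import all_boot all_order all_algebra.
From mathcomp Require Import all_classical all_reals all_analysis.
From mathcomp Require Import lra.

Set Implicit Arguments.
Unset Strict Implicit.
Unset Printing Implicit Defensive.

Import Order.TTheory GRing.Theory Num.Theory.

Local Open Scope classical_set_scope.
Local Open Scope ring_scope.
Local Open Scope ereal_scope.

(** * Finite measures of equal mass and their couplings *)

Definition couples (R : realType) (d : measure_display) (T : measurableType d)
    (Q : set (T * T) -> \bar R) (mu nu : set T -> \bar R) : Prop :=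
  forall A : set T, measurable A ->
    pushforward Q fst A = mu A /\ pushforward Q snd A = nu A.

Lemma measurable_fst_preimage (d : measure_display) (T : measurableType d)
    (A : set T) :
  measurable A -> measurable ((fst : T * T -> T) @^-1` A).
Proof.
by move=> mA; rewrite -[X in measurable X]setTI; exact: measurable_fst.
Qed.

Lemma measurable_snd_preimage (d : measure_display) (T : measurableType d)
    (A : set T) :
  measurable A -> measurable ((snd : T * T -> T) @^-1` A).
Proof.
by move=> mA; rewrite -[X in measurable X]setTI; exact: measurable_snd.
Qed.

(** Finite measures are charges; the difference of the two charges is nonnegative on measurable
    sets, hence comes from a measure. This supplies the leftover mass in [residual_limit]. *)
Lemma measure_difference (R : realType) (d : measure_display)
    (T : measurableType d) (mu nu : {measure set T -> \bar R}) :
  mu setT < +oo ->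
  (forall A, measurable A -> nu A <= mu A) ->
  exists kappa : {measure set T -> \bar R},
    forall A, measurable A -> mu A = nu A + kappa A.
Proof.
move=> mufin numu.
have fin (lambda : {measure set T -> \bar R}) :
    lambda setT < +oo -> fin_num_fun lambda.
  move=> lfin A mA; rewrite ge0_fin_numE// (le_lt_trans _ lfin)//.
  by rewrite le_measure ?inE.
have mufin' := fin _ mufin.
have nufin' := fin _ (le_lt_trans (numu _ measurableT) mufin).
have ch (lambda : {measure set T -> \bar R}) : fin_num_fun lambda ->
    exists lambda' : (Charge.type T R), lambda' = lambda :> (set T -> \bar R).
  move=> lfin.
  by exists (HB.pack_for (Charge.type T R) (fun A => lambda A)
    (isCharge.Build d T R (fun A => lambda A) (measure0 lambda) lfin
      (@measure_semi_sigma_additive _ _ _ lambda))).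
have [mu' mu'E] := ch _ mufin'; have [nu' nu'E] := ch _ nufin'.
pose diff := cadd mu' (copp nu').
have diffE A : diff A = mu A - nu A by rewrite -mu'E -nu'E.
(* A measure must be nonnegative on the nonmeasurable sets too, hence [crestr0]. *)
have diff_ge0 A : 0 <= crestr0 diff measurableT A.
  rewrite /crestr0; case: ifPn => // /[!inE] mA.
  by rewrite /crestr setIT diffE sube_ge0 ?numu// nufin'.
exists (measure_of_charge _ diff_ge0) => A mA.
rewrite [kappa in _ + kappa](_ : _ = crestr0 diff measurableT A)//.
rewrite /crestr0 mem_set// /crestr setIT diffE.
by rewrite addeC subeK// nufin'.
Qed.

(** Strong duality speaks of probabilities, while residuals are finite measures of smaller mass;
    this bridges the two. [P] is the default value of [mnormalize] at mass zero, where [c] is 0. *)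
Lemma normalize_pair (R : realType) (d : measure_display)
    (T : measurableType d) (P : probability T R)
    (mu nu : {measure set T -> \bar R}) :
  mu setT < +oo -> mu setT = nu setT ->
  exists (c : {nonneg R}) (p p' : probability T R),
    forall A, measurable A ->
      mu A = c%:num%:E * p A /\ nu A = c%:num%:E * p' A.
Proof.
move=> mufin munu.
have norm (lambda : {measure set T -> \bar R}) A : lambda setT < +oo ->
    measurable A ->
    lambda A = (fine (lambda setT))%:E * mnormalize lambda P A.
  move=> lfin mA.
  have lfin' : lambda setT \is a fin_num by rewrite ge0_fin_numE.
  rewrite /mnormalize /= (lt_eqF lfin) orbF; case: ifPn => [/eqP l0|l0].
    rewrite l0 mul0e; apply/eqP; rewrite -measure_le0 -l0.
    by rewrite le_measure ?inE.
  by rewrite muleCA -EFinM divff ?mule1// fine_eq0.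
exists (NngNum (fine_ge0 (measure_ge0 mu setT))).
exists (mnormalize mu P), (mnormalize nu P) => A mA; split; first exact: norm.
by rewrite /= munu; apply: norm => //; rewrite -munu.
Qed.

Lemma scaled_couples (R : realType) (d : measure_display)
    (T : measurableType d) (c : {nonneg R}) (Q : {measure set (T * T) -> \bar R})
    (p p' mu nu : set T -> \bar R) :
  (forall A, measurable A ->
    mu A = c%:num%:E * p A /\ nu A = c%:num%:E * p' A) ->
  couples Q p p' -> couples (mscale c Q) mu nu.
Proof.
move=> munu Qpp' A mA; have [-> ->] := munu A mA.
by have [<- <-] := Qpp' A mA.
Qed.

(** The product of the normalized measures, scaled back by the common mass. *)
Lemma exists_couples (R : realType) (d : measure_display)
    (T : measurableType d) (P : probability T R)
    (mu nu : {measure set T -> \bar R}) :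
  mu setT < +oo -> mu setT = nu setT ->
  exists N : {measure set (T * T) -> \bar R}, couples N mu nu.
Proof.
move=> mufin /(normalize_pair P mufin)[c [p [p' munu]]].
exists (mscale c (p \x p')); apply: (scaled_couples munu) => A mA.
rewrite /pushforward; split.
  transitivity ((p \x p') (A `*` setT)); first by rewrite setXT.
  by rewrite product_measure1E// -[RHS]mule1 -(probability_setT p').
transitivity ((p \x p') (setT `*` A)); first by rewrite setTX.
by rewrite product_measure1E// -[RHS]mul1e -(probability_setT p).
Qed.

(** * Invariant sets and complementary slackness *)

Definition invariant_set (T : Type) (E : set (T * T)) (A : set T) : Prop :=
  forall x y, E (x, y) -> A x <-> A y.

(** Off [E], up to a null set, [Q] only moves mass from [A] to its complement. *)
Definition slack (R : realType) (T : Type) (E : set (T * T)) (A : set T)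
    (Q : set (T * T) -> \bar R) : Prop :=
  Q (fst @^-1` (~` A) `&` ~` E) = 0 /\ Q (snd @^-1` A `&` ~` E) = 0.

Lemma invariant_setI_preimage (T : Type) (E : set (T * T)) (A : set T) :
  invariant_set E A -> fst @^-1` A `&` E = snd @^-1` A `&` E.
Proof.
by move=> inv; apply/seteqP; split=> -[x y] /= [Az Exy]; split=> //;
  apply/(inv x y).
Qed.

(** Duality is tested on the Dirac masses at two related points [x] and [y]: the Dirac mass at
    [(x, y)] is a coupling of cost 0, so no set of [G] separates them. *)
Lemma strong_duality_invariant (R : realType) (d : measure_display)
    (T : measurableType d) (E : set (T * T)) (G : set (set T)) (A : set T) :
  strong_duality R E G -> G A -> invariant_set E A.
Proof.
move=> [_ dual] GA x y Exy.
have [_ _ supinf] := dual (\d_x : probability T R) (\d_y : probability T R).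
have : `|\d_x A - \d_y A| <= 1 - \d_(x, y) E :> \bar R.
  apply: (@le_trans _ _ (ereal_sup [set `|\d_x B - \d_y B| | B in G])).
    by apply: ereal_sup_ubound; exists A.
  rewrite supinf; apply: ereal_inf_lbound.
  by exists (\d_(x, y) : probability (T * T)%type R).
rewrite (diracE _ (x, y)) mem_set// subee// !diracE -EFinB abse_EFin lee_fin.
(* [odd] recovers the membership booleans from their values as natural numbers. *)
rewrite normr_le0 subr_eq0 eqr_nat => /eqP/(congr1 odd); rewrite !oddb => xyA.
by rewrite -(in_setE A) xyA in_setE.
Qed.

(** By invariance, [fst] in [A] and [snd] in [A] are the same event within [E], so the gap only sees
    the mass off [E]. With the four pieces of that mass named as reals, the duality arguments below
    become linear arithmetic. *)
Lemma couples_gap (R : realType) (d : measure_display)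
    (T : measurableType d) (P P' : probability T R)
    (Q : probability (T * T)%type R) (E : set (T * T)) (A : set T) :
  couples Q P P' -> measurable E -> measurable A -> invariant_set E A ->
  exists a a' b b' : R,
    [/\ [/\ (0 <= a)%R, (0 <= a')%R, (0 <= b)%R & (0 <= b')%R],
        Q (fst @^-1` A `&` ~` E) = a%:E /\ Q (fst @^-1` (~` A) `&` ~` E) = a'%:E,
        Q (snd @^-1` A `&` ~` E) = b%:E /\ Q (snd @^-1` (~` A) `&` ~` E) = b'%:E,
        1 - Q E = (a + a')%:E /\ (a + a' = b + b')%R &
        P A - P' A = (a - b)%:E].
Proof.
move=> QPP' mE mA inv; have mEc := measurableC mE.
have mAc := measurableC mA.
have mfA := measurable_fst_preimage mA; have msA := measurable_snd_preimage mA.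
have mfst X : measurable X -> measurable ((fst : T * T -> T) @^-1` X `&` ~` E).
  by move=> mX; apply: measurableI => //; exact: measurable_fst_preimage.
have msnd X : measurable X -> measurable ((snd : T * T -> T) @^-1` X `&` ~` E).
  by move=> mX; apply: measurableI => //; exact: measurable_snd_preimage.
have Qfin X : measurable X -> Q X = (fine (Q X))%:E.
  by move=> mX; rewrite fineK// fin_num_measure.
have split_compl (X : set (T * T)) : measurable X ->
    Q (~` E) = Q (X `&` ~` E) + Q (~` X `&` ~` E).
  by move=> mX; rewrite (measureDI Q mEc mX) setDE addeC !(setIC (~` E)).
have split_E (X : set (T * T)) : measurable X ->
    Q X = Q (X `&` E) + Q (X `&` ~` E).
  by move=> mX; rewrite (measureDI Q mX mE) setDE addeC.
exists (fine (Q (fst @^-1` A `&` ~` E))), (fine (Q (fst @^-1` (~` A) `&` ~` E))).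
exists (fine (Q (snd @^-1` A `&` ~` E))), (fine (Q (snd @^-1` (~` A) `&` ~` E))).
have [PA P'A] := QPP' A mA.
have cE : 1 - Q E = Q (~` E) by rewrite probability_setC.
split.
- by split; apply: fine_ge0.
- by split; apply: Qfin; auto.
- by split; apply: Qfin; auto.
- rewrite cE; split.
    by rewrite (split_compl (fst @^-1` A))// EFinD -!Qfin; auto.
  apply: EFin_inj; rewrite !EFinD -!Qfin; auto.
  by rewrite -(split_compl (fst @^-1` A))// -(split_compl (snd @^-1` A)).
- have mAE : measurable (fst @^-1` A `&` E) by exact: measurableI.
  rewrite -PA -P'A /pushforward split_E// (split_E (snd @^-1` A))//.
  rewrite -(invariant_setI_preimage inv) (Qfin _ mAE).
  rewrite [in LHS](Qfin _ (mfst _ mA)) [in LHS](Qfin _ (msnd _ mA)).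
  rewrite -!EFinD; congr EFin. lra.
Qed.

Lemma strong_duality_slack (R : realType) (d : measure_display)
    (T : measurableType d) (E : set (T * T)) (G : set (set T))
    (P : probability T R) (mu nu : {measure set T -> \bar R}) :
  sub_sigma_algebra_of G -> strong_duality R E G ->
  mu setT < +oo -> mu setT = nu setT ->
  exists (Q : {measure set (T * T) -> \bar R}) (A : set T),
    [/\ couples Q mu nu, G A & slack E A Q].
Proof.
move=> [sG Gm] dual mufin munu.
have [c [p [p' cpp']]] := normalize_pair P mufin munu.
suff [Q [A [Qpp' GA [s1 s2]]]] : exists (Q : probability (T * T)%type R) A,
    [/\ couples Q p p', G A & slack E A Q].
  exists (mscale c Q), A; split => //; first exact: scaled_couples cpp' Qpp'.
  by split; [move: s1|move: s2] => /(congr1 (mule c%:num%:E)); rewrite mule0.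
have [mE /(_ p p')/= [[A GA gapA] [Q Qpp' costQ] gapcost]] := dual.
have GAc : G (~` A) by rewrite -setTD; have [_ ? _] := sG; auto.
have mA := Gm _ GA.
have inv := strong_duality_invariant dual GA.
have [a [a' [b [b' [[a0 a'0 b0 b'0] [aE a'E] [bE b'E] [cE ab] dE]]]]] :=
  couples_gap Qpp' mE mA inv.
move: gapA; rewrite gapcost -costQ cE dE abse_EFin => -[].
(* Optimality reads |a - b| = a + a' = b + b'. If a >= b, then a' = b = 0; otherwise a = b' = 0 and
   the complement of [A] has the required slackness. *)
have [ba|abneg] := lerP 0 (a - b)%R.
  rewrite ger0_norm// => e.
  exists Q, A; split=> //; split; first by rewrite a'E; congr EFin; lra.
  by rewrite bE; congr EFin; lra.
rewrite ltr0_norm// => e.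
exists Q, (~` A); split=> //; split; first by rewrite setCK aE; congr EFin; lra.
by rewrite b'E; congr EFin; lra.
Qed.

(** Weak duality is |a - b| <= a + a' in the notation of [couples_gap]. Slackness forces a' = b = 0,
    so a gap equals a cost and both extrema are attained there. *)
Lemma slack_strong_duality (R : realType) (d : measure_display)
    (T : measurableType d) (E : set (T * T)) (G : set (set T)) :
  measurable E -> G `<=` measurable ->
  (forall A, G A -> invariant_set E A) ->
  (forall P P' : probability T R,
    exists (Q : {measure set (T * T) -> \bar R}) (A : set T),
      [/\ couples Q P P', G A & slack E A Q]) ->
  strong_duality R E G.
Proof.
move=> mE Gm inv ex; split=> // P P'.
set gaps := image G _; set costs := image _ _.
have weak x y : gaps x -> costs y -> x <= y.
  move=> [A GA <-] [Q QPP' <-].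
  have [a [a' [b [b' [[a0 a'0 b0 b'0] _ _ [-> ab] ->]]]]] :=
    couples_gap QPP' mE (Gm _ GA) (inv _ GA).
  by rewrite abse_EFin lee_fin ler_norml; apply/andP; split; lra.
have [x [gx cx]] : exists x, gaps x /\ costs x.
  have [Q [A [QPP' GA sl]]] := ex P P'.
  have Q1 : Q setT = 1.
    by have [+ _] := QPP' _ measurableT; rewrite probability_setT.
  exists (`|P A - P' A|); split; first by exists A.
  (* [Q] has mass 1, so normalizing leaves it unchanged and only equips it with the structure of a
     probability. *)
  pose Q' : probability (T * T)%type R := mnormalize Q (P \x P').
  have Q'E : Q' = Q :> (set (T * T) -> \bar R).
    apply/funext => X; rewrite /Q' /= /mnormalize /= Q1 onee_eq0 /=.
    by rewrite invr1 mule1.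
  have Q'PP' : couples Q' P P' by move=> B mB; rewrite Q'E; exact: QPP'.
  exists Q' => //.
  have [a [a' [b [b' [[a0 a'0 b0 b'0] [_ a'E] [bE _] [-> ab] ->]]]]] :=
    couples_gap Q'PP' mE (Gm _ GA) (inv _ GA).
  move: sl a'E bE; rewrite Q'E => -[-> ->] [<-] [<-].
  by rewrite abse_EFin subr0 addr0 ger0_norm.
have supE : ereal_sup gaps = x.
  apply/eqP; rewrite eq_le ereal_sup_ubound// andbT.
  by apply: ge_ereal_sup => y gy; exact: weak.
have infE : ereal_inf costs = x.
  apply/eqP; rewrite eq_le ereal_inf_lbound//=.
  by apply: le_ereal_inf_tmp => y cy; exact: weak.
by split; rewrite ?supE ?infE.
Qed.

(** * Marginals, null sets, limits of residuals and limsups of sets *)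

Lemma exists_marginals (R : realType) (d : measure_display)
    (T : measurableType d) (Q : {measure set (T * T) -> \bar R}) :
  exists mu nu : {measure set T -> \bar R}, couples Q mu nu.
Proof.
unshelve eexists (pushforward Q fst : {measure set T -> \bar R}).
  exact: measurable_fst.
unshelve eexists (pushforward Q snd : {measure set T -> \bar R}).
  exact: measurable_snd.
by [].
Qed.

Lemma bigcup_measure0 (R : realType) (d : measure_display)
    (T : measurableType d) (mu : {measure set T -> \bar R})
    (F : nat -> set T) (B : set T) :
  measurable B -> B `<=` \bigcup_n F n -> (forall n, measurable (F n)) ->
  (forall n, mu (F n) = 0) -> mu B = 0.
Proof.
move=> mB BF mF F0; apply: measure_negligible => //.
apply: negligibleS BF _; apply: negligible_bigcup => n.
by apply/negligibleP; [exact: mF|exact: F0].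
Qed.

(** Telescoping gives [mu 0 B] as the n-th partial sum plus [mu n B]. Hence the series stays below
    [mu 0], and [kappa] is the difference; cancelling the finite partial sum bounds [kappa] by each
    [mu n]. *)
Lemma residual_limit (R : realType) (d : measure_display)
    (T : measurableType d) (mu m : nat -> {measure set T -> \bar R}) :
  mu 0%N setT < +oo ->
  (forall n B, measurable B -> mu n B = m n B + mu n.+1 B) ->
  exists kappa : {measure set T -> \bar R}, forall B, measurable B ->
    mu 0%N B = mseries m 0 B + kappa B /\ forall n, kappa B <= mu n B.
Proof.
move=> mufin rec.
have partial n B : measurable B ->
    mu 0%N B = \sum_(0 <= k < n) m k B + mu n B.
  move=> mB; elim: n => [|n ->]; first by rewrite big_geq// add0e.
  by rewrite big_nat_recr//= -addeA -rec.
have partial_ge0 n B : 0 <= \sum_(0 <= k < n) m k B by exact: sume_ge0.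
have series_le B : measurable B -> mseries m 0 B <= mu 0%N B.
  move=> mB; apply: lime_le; first exact: is_cvg_nneseries.
  by apply: nearW => n; rewrite (partial n B mB) leeDl.
have [kappa kappaE] := measure_difference mufin series_le.
exists kappa => B mB; split=> [|n]; first exact: kappaE.
have partial_fin : \sum_(0 <= k < n) m k B \is a fin_num.
  rewrite ge0_fin_numE//; apply: le_lt_trans mufin.
  apply: (@le_trans _ _ (mu 0%N B)); first by rewrite (partial n B mB) leeDl.
  by rewrite le_measure ?inE.
rewrite -(leeD2lE _ _ partial_fin) -(partial n B mB) (kappaE B mB) leeD2r//.
exact: nneseries_lim_ge.
Qed.

Lemma limsup_sigma_algebra (T : Type) (G : nat -> set (set T))
    (A : nat -> set T) :
  (forall n, sigma_algebra [set: T] (G n)) -> (forall n, G n.+1 `<=` G n) ->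
  (forall n, G n (A n)) ->
  (\bigcap_n G n) (\bigcap_i \bigcup_j A (i + j)%N).
Proof.
move=> sG dG GA k _.
have GS i j : G (i + j)%N `<=` G i.
  by elim: j => [|j IH]; rewrite ?addn0// addnS => X /dG/IH.
have [_ GC GU] := sG k.
(* A limsup ignores the first [k] terms, and all later ones lie in [G k]; complements turn the
   intersection into a union. *)
have -> : \bigcap_i \bigcup_j A (i + j)%N =
    setT `\` \bigcup_i (setT `\` \bigcup_j A (k + (i + j))%N).
  rewrite setTD setC_bigcup; apply/seteqP; split=> x Ax i _.
    rewrite setTD setCK.
    by have [j _ Aj] := Ax (k + i)%N I; exists j => //; rewrite addnA.
  have := Ax i I; rewrite setTD setCK => -[j _ Aj].
  by exists (k + j)%N => //; rewrite addnCA.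
apply: (GC); apply: (GU) => i; apply: (GC); apply: (GU) => j.
exact: GS (GA _).
Qed.

(** * Rounds of matching and their iteration *)

Definition matching (R : realType) (d : measure_display) (T : measurableType d)
    (E : set (T * T)) (A : set T) (mu nu : set T -> \bar R)
    (Q : set (T * T) -> \bar R) (m m' mu' nu' : set T -> \bar R) : Prop :=
  [/\ couples Q m m', Q (~` E) = 0,
      forall B, measurable B -> mu B = m B + mu' B /\ nu B = m' B + nu' B,
      mu' setT = nu' setT & mu' (~` A) = 0 /\ nu' A = 0].

(** A slack coupling is cut into its restrictions to [E] and to the complement of [E]. The first is
    the matched part, with marginals [m] and [m']; the marginals of the second are the residuals,
    and slackness says that [A] separates them. *)
Lemma exists_matching (R : realType) (d : measure_display)
    (T : measurableType d) (E : set (T * T)) (G : set (set T))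
    (P : probability T R) (mu nu : {measure set T -> \bar R}) :
  sub_sigma_algebra_of G -> strong_duality R E G ->
  mu setT < +oo -> mu setT = nu setT ->
  exists (A : set T) (Q : {measure set (T * T) -> \bar R})
      (m m' mu' nu' : {measure set T -> \bar R}),
    G A /\ matching E A mu nu Q m m' mu' nu'.
Proof.
move=> sG dual mufin munu.
have [Q [A [Qmunu GA [sA sA']]]] := strong_duality_slack P sG dual mufin munu.
have mE : measurable E by case: dual.
have mA : measurable A by apply: sG.2.
have mEc := measurableC mE.
have [m [m' Qm]] := exists_marginals (mrestr Q mE).
have [mu' [nu' Qmu']] := exists_marginals (mrestr Q mEc).
exists A, (mrestr Q mE), m, m', mu', nu'; split => //; split => //.
- by rewrite /= /mrestr setICl measure0.
- move=> B mB; have [<- <-] := Qmunu B mB.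
  have [<- <-] := Qm B mB; have [<- <-] := Qmu' B mB.
  rewrite /pushforward /= /mrestr; split.
    rewrite addeC -setDE -measureDI//; exact: measurable_fst_preimage.
  rewrite addeC -setDE -measureDI//; exact: measurable_snd_preimage.
- by have [<- <-] := Qmu' _ measurableT.
- have [<- _] := Qmu' _ (measurableC mA); have [_ <-] := Qmu' _ mA.
  by split.
Qed.

Lemma exists_matching_sequence (R : realType) (d : measure_display)
    (T : measurableType d) (E : nat -> set (T * T)) (G : nat -> set (set T))
    (P P' : probability T R) :
  (forall n, sub_sigma_algebra_of (G n)) ->
  (forall n, strong_duality R (E n) (G n)) ->
  exists (A : nat -> set T) (Q : nat -> {measure set (T * T) -> \bar R})
      (m m' mu nu : nat -> {measure set T -> \bar R}),
    [/\ mu 0%N = P :> (set T -> \bar R), nu 0%N = P' :> (set T -> \bar R),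
        forall n, G n (A n) &
        forall n, matching (E n) (A n) (mu n) (nu n)
                           (Q n) (m n) (m' n) (mu n.+1) (nu n.+1)].
Proof.
move=> sG dual; pose meas := {measure set T -> \bar R}.
pose meas2 := {measure set (T * T) -> \bar R}.
(* The invariant that allows one more round, preserved from residual to residual. *)
pose good (s : meas * meas) := s.1 setT < +oo /\ s.1 setT = s.2 setT.
pose outcome := (set T * meas2 * (meas * meas) * (meas * meas))%type.
pose step n (s : meas * meas) (r : outcome) :=
  G n r.1.1.1 /\ matching (E n) r.1.1.1 s.1 s.2 r.1.1.2
                          r.1.2.1 r.1.2.2 r.2.1 r.2.2.
have [f fP] : {f : nat * (meas * meas) -> outcome &
    forall x, good x.2 -> step x.1 x.2 (f x)}.
  apply: (@choice _ _ (fun x r => good x.2 -> step x.1 x.2 r)) => -[n [mu nu]].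
  have [[/= mufin munu]|ngood] := pselect (good (mu, nu)); last first.
    (* A dummy outcome makes the choice function total. *)
    by exists (set0, (mzero : meas2), (mu, nu), (mu, nu)) => /ngood.
  have [A [Q [m [m' [mu' [nu' AQ]]]]]] :=
    exists_matching P (sG n) (dual n) mufin munu.
  by exists (A, Q, (m, m'), (mu', nu')).
pose S := nat_rect (fun=> (meas * meas)%type)
  (P : meas, P' : meas) (fun n s => (f (n, s)).2).
have Sgood n : good (S n).
  elim: n => [|n IH].
    by split; rewrite /= !probability_setT ?ltry.
  have [_ [_ _ split_mass mass _]] := fP (n, S n) IH.
  split; last exact: mass.
  apply: le_lt_trans IH.1; have [-> _] := split_mass _ measurableT.
  by rewrite leeDr.
pose F n := f (n, S n); have FP n : step n (S n) (F n) := fP (n, S n) (Sgood n).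
exists (fun n => (F n).1.1.1), (fun n => (F n).1.1.2), (fun n => (F n).1.2.1),
  (fun n => (F n).1.2.2), (fun n => (S n).1), (fun n => (S n).2).
by split=> // n; have [] := FP n.
Qed.

(** * Passage to the limit of the rounds *)

Theorem theorem3p14 (R : realType) (d : measure_display)
    (Omega : measurableType d)
    (E : nat -> set (Omega * Omega)) (G : nat -> set (set Omega)) :
  standard_borel R Omega ->
  (forall n : nat, equivalence_set (E n)) ->
  (forall n : nat, E n `<=` E n.+1) ->
  (forall n : nat, sub_sigma_algebra_of (G n)) ->
  (forall n : nat, G n.+1 `<=` G n) ->
  (forall n : nat, strong_duality R (E n) (G n)) ->
  strong_duality R (\bigcup_n E n) (\bigcap_n G n).
Proof.
move=> _ _ _ sG dG dual.
have mE : measurable (\bigcup_n E n).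
  by apply: bigcupT_measurable => n; case: (dual n).
have Gm : \bigcap_n G n `<=` measurable.
  by move=> A /(_ 0%N I); apply: (sG 0%N).2.
apply: slack_strong_duality => //.
  move=> A GA x y [n _ Exy].
  exact: (strong_duality_invariant (dual n) (GA n I)).
move=> P P'.
have [A [Q [m [m' [mu [nu [mu0 nu0 GA match_n]]]]]]] :=
  exists_matching_sequence P P' sG dual.
have mA n : measurable (A n) by apply: (sG n).2.
(* [kappa], and [lambda] below, are what all the rounds leave unmatched of [P] and [P']. *)
have [kappa kappaP] : exists kappa : {measure set Omega -> \bar R},
    forall B, measurable B ->
    mu 0%N B = mseries m 0 B + kappa B /\ forall n, kappa B <= mu n B.
  apply: residual_limit; first by rewrite mu0 probability_setT ltry.
  by move=> n B mB; have [_ _ /(_ B mB)[]] := match_n n.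
have [lambda lambdaP] : exists lambda : {measure set Omega -> \bar R},
    forall B, measurable B ->
    nu 0%N B = mseries m' 0 B + lambda B /\ forall n, lambda B <= nu n B.
  apply: residual_limit; first by rewrite nu0 probability_setT ltry.
  by move=> n B mB; have [_ _ /(_ B mB)[]] := match_n n.
have Qm B : measurable B ->
    mseries Q 0 (fst @^-1` B) = mseries m 0 B /\
    mseries Q 0 (snd @^-1` B) = mseries m' 0 B.
  move=> mB; split; apply: eq_eseriesr => n _;
    by have [/(_ B mB)[]] := match_n n.
have kappa_fin : kappa setT < +oo.
  apply: le_lt_trans ((kappaP _ measurableT).2 0%N) _.
  by rewrite mu0 probability_setT ltry.
(* The matched mass is the same on both sides and at most 1, so it cancels from the two total
   masses. *)
have kappa_lambda : kappa setT = lambda setT.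
  have [muT _] := kappaP _ measurableT; have [nuT _] := lambdaP _ measurableT.
  have [Qm1 Qm2] := Qm _ measurableT.
  rewrite mu0 probability_setT in muT; rewrite nu0 probability_setT in nuT.
  have mm' : mseries m 0 setT = mseries m' 0 setT.
    by rewrite -Qm1 -Qm2 !preimage_setT.
  have mfin : mseries m 0 setT \is a fin_num.
    rewrite ge0_fin_numE//; apply: (@le_lt_trans _ _ 1); last exact: ltry.
    by rewrite muT leeDl.
  rewrite -[LHS](addeK _ mfin) -[RHS](addeK _ mfin).
  by rewrite ![_ + mseries m 0 setT]addeC -muT mm' -nuT.
have [N Nkl] := exists_couples P kappa_fin kappa_lambda.
pose L := \bigcap_i \bigcup_j A (i + j)%N.
exists (measure_add (mseries Q 0) N), L.
have GL : (\bigcap_n G n) L.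
  by apply: limsup_sigma_algebra => // n; exact: (sG n).1.
have mL : measurable L by exact: Gm.
(* The residual that [A n] separates is the one of index [n.+1]; it dominates [kappa], which
   therefore vanishes off every [A n]. A point outside the limsup misses some [A n]. *)
have kappaL : kappa (~` L) = 0.
  apply: (@bigcup_measure0 _ _ _ _ (fun n => ~` A n)).
  - exact: measurableC.
  - rewrite /L setC_bigcap => x [i _ nAx]; exists i => // Ax.
    by apply: nAx; exists 0%N => //; rewrite addn0.
  - by move=> n; exact: measurableC.
  - move=> n; have [_ _ _ _ [mu'0 _]] := match_n n.
    apply/eqP; rewrite -measure_le0 -mu'0.
    exact: (kappaP _ (measurableC (mA n))).2.
have lambdaL : lambda L = 0.
  apply: (@bigcup_measure0 _ _ _ _ A) => //.
    by move=> x /(_ 0%N I)[j _ Ax]; exists j.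
  move=> n; have [_ _ _ _ [_ nu'0]] := match_n n.
  apply/eqP; rewrite -measure_le0 -nu'0.
  exact: (lambdaP _ (mA n)).2.
(* Each [Q n] is carried by [E n], so off the union only [N] can have mass. Slackness thus reduces
   to [N], whose marginals are [kappa] and [lambda]. *)
have slackX X : measurable X -> N X = 0 ->
    measure_add (mseries Q 0) N (X `&` ~` \bigcup_n E n) = 0.
  move=> mX NX; have mEc := measurableC mE.
  have mXE : measurable (X `&` ~` \bigcup_n E n) by exact: measurableI.
  rewrite measure_addE (@subset_measure0 _ _ _ N _ X)// adde0.
  apply: eseries0 => n _ _.
  have [_ QE _ _ _] := match_n n.
  have mEn : measurable (E n) by case: (dual n).
  apply: (@subset_measure0 _ _ _ (Q n) _ (~` E n)) => //.
    exact: measurableC.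
  by move=> x [_ nEx] Ex; apply: nEx; exists n.
split => //.
- move=> B mB; have [N1 N2] := Nkl B mB; have [Q1 Q2] := Qm B mB.
  have [kB _] := kappaP B mB; have [lB _] := lambdaP B mB.
  rewrite -mu0 -nu0 kB lB -N1 -N2 -Q1 -Q2.
  by split; exact: measure_addE.
- split; apply: slackX.
  + by apply: measurable_fst_preimage; exact: measurableC.
  + by have [] := Nkl _ (measurableC mL); rewrite /pushforward kappaL.
  + exact: measurable_snd_preimage.
  + by have [_] := Nkl _ mL; rewrite /pushforward lambdaL.
Qed.
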